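(* Let $\Gamma$ be a finite graph with chromatic number $k$. Then the associated right-angled Artin group $G(\Gamma)$ acts properly, preserving factors, on a product of $k$ trees.
   Context: Graphs defining right-angled Artin groups (RAAGs) are finite and simplicial; $G(\Gamma)$ has one generator for each vertex of $\Gamma$, with defining relations that two generators commute whenever the corresponding vertices are joined by an edge. Trees are simplicial trees, not necessarily locally finite. A group $G$ acts on a product of trees $P=T_1\times\cdots\times T_n$ preserving factors if the action is given by a homomorphism $G\to\mathrm{Aut}(T_1)\times\cdots\times\mathrm{Aut}(T_n)$. The action is proper if the stabiliser of every vertex of $P$ is finite. *)

(* Defs.v *)
From HB Require Import structures.
From mathcomp Require Import all_boot.
From mathcomp Require Import boolp classical_sets functions cardinality.

Set Implicit Arguments.
Unset Strict Implicit.
Unset Printing Implicit Defensive.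

Local Open Scope group_scope.
Local Open Scope quotient_scope.

Record simple_graph (V : Type) := SimpleGraph {
  adj :> rel V;
  adj_sym : symmetric adj;
  adj_irr : irreflexive adj
}.

Section ChromaticNumber.
Variables (V : finType) (Gamma : simple_graph V).

Definition colorable (k : nat) : bool :=
  [exists c : {ffun V -> 'I_k},
     [forall x, forall y, Gamma x y ==> (c x != c y)]].

Lemma colorable_card : colorable #|V|.
Proof.
apply/existsP; exists [ffun x => enum_rank x].
apply/forallP => x; apply/forallP => y; apply/implyP => xy; rewrite !ffunE.
by apply: contraTneq xy => /enum_rank_inj ->; rewrite adj_irr.
Qed.

Definition chromatic_number : nat := ex_minn (ex_intro colorable _ colorable_card).

End ChromaticNumber.

(* Words in X and its formal inverses: (x, false) is x and (x, true) is x^-1. *)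
Definition word (X : Type) := seq (X * bool).

Definition word_inv (X : Type) (w : word X) : word X :=
  rev [seq (l.1, ~~ l.2) | l <- w].

(* R w1 w2 is read as a defining relation w1 = w2. *)
Inductive pres_eqv (X : Type) (R : word X -> word X -> Prop) :
    word X -> word X -> Prop :=
| pres_refl w : pres_eqv R w w
| pres_sym w1 w2 : pres_eqv R w1 w2 -> pres_eqv R w2 w1
| pres_trans w2 w1 w3 : pres_eqv R w1 w2 -> pres_eqv R w2 w3 -> pres_eqv R w1 w3
| pres_cancel u x b v : pres_eqv R (u ++ [:: (x, b); (x, ~~ b)] ++ v) (u ++ v)
| pres_relator u w1 w2 v : R w1 w2 -> pres_eqv R (u ++ w1 ++ v) (u ++ w2 ++ v).

Section Presentation.
Variables (X : choiceType) (R : word X -> word X -> Prop).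

Definition pres_rel (w1 w2 : seq (X * bool)) : bool := `[< pres_eqv R w1 w2 >].

Fact pres_rel_refl : reflexive pres_rel.
Proof. by move=> w; apply/asboolP; apply: pres_refl. Qed.

Fact pres_rel_sym : symmetric pres_rel.
Proof. by move=> u v; apply/asboolP/asboolP; apply: pres_sym. Qed.

Fact pres_rel_trans : transitive pres_rel.
Proof.
by move=> v u w /asboolP uv /asboolP vw; apply/asboolP; apply: pres_trans vw.
Qed.

Canonical pres_equiv := EquivRel pres_rel pres_rel_refl pres_rel_sym pres_rel_trans.

Definition presented : Type := {eq_quot pres_equiv}.
HB.instance Definition _ := Choice.on presented.
HB.instance Definition _ := EqQuotient.on presented.

Definition pres_of (w : word X) : presented := \pi w.

Lemma pres_ofP w1 w2 : pres_of w1 = pres_of w2 <-> pres_eqv R w1 w2.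
Proof.
by split=> [/eqP|h]; [rewrite /pres_of eqmodE => /asboolP|
  apply/eqP; rewrite /pres_of eqmodE; apply/asboolP].
Qed.

Lemma pres_of_repr (a : presented) : pres_of (repr a) = a.
Proof. exact: reprK. Qed.

Definition pres_one : presented := pres_of [::].
Definition pres_mul (a b : presented) : presented := pres_of (repr a ++ repr b).
Definition pres_inv (a : presented) : presented := pres_of (word_inv (repr a)).

Lemma pres_eqv_ctx u w1 w2 v :
  pres_eqv R w1 w2 -> pres_eqv R (u ++ w1 ++ v) (u ++ w2 ++ v).
Proof.
elim=> {w1 w2} [w|w1 w2 _|w2 w1 w3 _ h _|u' x b v'|u' w1 w2 v' r].
- exact: pres_refl.
- exact: pres_sym.
- exact: pres_trans.
- have := pres_cancel R (u ++ u') x b (v' ++ v).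
  by rewrite -!catA.
- have := pres_relator (u ++ u') (v' ++ v) r.
  by rewrite -!catA.
Qed.

Lemma pres_eqv_cat u u' v v' :
  pres_eqv R u u' -> pres_eqv R v v' -> pres_eqv R (u ++ v) (u' ++ v').
Proof.
move=> uu' vv'; apply: (@pres_trans _ _ (u' ++ v)).
  exact: (@pres_eqv_ctx [::] u u' v).
by have := pres_eqv_ctx u' [::] vv'; rewrite !cats0.
Qed.

Lemma pres_mulE w1 w2 : pres_mul (pres_of w1) (pres_of w2) = pres_of (w1 ++ w2).
Proof.
by apply/pres_ofP; apply: pres_eqv_cat; apply/pres_ofP; rewrite pres_of_repr.
Qed.

Lemma word_invK : involutive (@word_inv X).
Proof.
move=> w; rewrite /word_inv map_rev revK -map_comp -[RHS]map_id.
by apply: eq_map => -[x b] /=; rewrite negbK.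
Qed.

Lemma pres_eqv_mulV w : pres_eqv R (w ++ word_inv w) [::].
Proof.
elim: w => [|[x b] w IHw]; first exact: pres_refl.
have -> : ((x, b) :: w) ++ word_inv ((x, b) :: w) =
          [:: (x, b)] ++ (w ++ word_inv w) ++ [:: (x, ~~ b)].
  by rewrite /word_inv /= rev_cons -cats1 catA.
apply: pres_trans (pres_eqv_ctx [:: (x, b)] [:: (x, ~~ b)] IHw) _.
exact: (pres_cancel R [::] x b [::]).
Qed.

Fact pres_mulA : associative pres_mul.
Proof.
move=> a b c; rewrite -(pres_of_repr a) -(pres_of_repr b) -(pres_of_repr c).
by rewrite !pres_mulE catA.
Qed.

Fact pres_mul1 : left_id pres_one pres_mul.
Proof. by move=> a; rewrite -(pres_of_repr a) pres_mulE. Qed.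

Fact pres_mulr1 : right_id pres_one pres_mul.
Proof. by move=> a; rewrite -(pres_of_repr a) pres_mulE cats0. Qed.

Fact pres_mulV : left_inverse pres_one pres_inv pres_mul.
Proof.
move=> a; rewrite -{2}(pres_of_repr a) pres_mulE; apply/pres_ofP.
by have := pres_eqv_mulV (word_inv (repr a)); rewrite word_invK.
Qed.

Fact pres_mulrV : right_inverse pres_one pres_inv pres_mul.
Proof.
move=> a; rewrite -{1}(pres_of_repr a) pres_mulE; apply/pres_ofP.
exact: pres_eqv_mulV.
Qed.

HB.instance Definition _ :=
  isGroup.Build presented pres_mulA pres_mul1 pres_mulr1 pres_mulV pres_mulrV.

End Presentation.

Inductive commutation (V : Type) (e : rel V) : word V -> word V -> Prop :=
| Commutation u v : e u v ->
    commutation e [:: (u, false); (v, false)] [:: (v, false); (u, false)].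

Definition raag (V : finType) (Gamma : simple_graph V) : groupType :=
  presented (commutation Gamma).

(* The choiceType structure on the vertices is no restriction, since every    *)
(* type has one classically. A ucycle of length two is an edge run through    *)
(* back and forth, hence the bound in tree_acyclic.                           *)
Record tree := Tree {
  tree_vertex :> choiceType;
  tree_adj : simple_graph tree_vertex;
  tree_nonempty : inhabited tree_vertex;
  tree_connected : forall x y : tree_vertex,
    exists2 p : seq tree_vertex, path tree_adj x p & last x p = y;
  tree_acyclic : forall c : seq tree_vertex, ucycle tree_adj c -> size c <= 2
}.

Record tree_aut (T : tree) := TreeAut {
  tree_aut_fun :> T -> T;
  tree_aut_inv : T -> T;
  tree_autK : cancel tree_aut_fun tree_aut_inv;
  tree_autVK : cancel tree_aut_inv tree_aut_fun;
  tree_aut_adj : {mono tree_aut_fun : x y / tree_adj T x y}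
}.

Section TreeAutGroup.
Variable T : tree.
Implicit Types f g : tree_aut T.

Lemma tree_autP f g : f =1 g -> f = g.
Proof.
case: f g => [f f' fK f'K fm] [g g' gK g'K gm] /= fg.
have {}fg : f = g by apply: funext.
case: _ / fg g' gK g'K gm => g' gK g'K gm.
have fg' : f' = g' by apply: funext => x; rewrite -{2}(f'K x) gK.
by case: _ / fg' gK g'K => gK g'K; congr TreeAut; apply: Prop_irrelevance.
Qed.

HB.instance Definition _ := gen_eqMixin (tree_aut T).
HB.instance Definition _ := gen_choiceMixin (tree_aut T).

Definition tree_aut_one : tree_aut T :=
  @TreeAut T id id (fun=> erefl) (fun=> erefl) (fun _ _ => erefl).

Fact tree_aut_inv_adj f : {mono tree_aut_inv f : x y / tree_adj T x y}.
Proof. by move=> x y; rewrite -(tree_aut_adj f) !tree_autVK. Qed.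

Definition tree_aut_invg f : tree_aut T :=
  TreeAut (tree_autVK f) (tree_autK f) (tree_aut_inv_adj f).

Fact tree_aut_mul_adj f g : {mono f \o g : x y / tree_adj T x y}.
Proof. by move=> x y /=; rewrite !tree_aut_adj. Qed.

Definition tree_aut_mul f g : tree_aut T :=
  TreeAut (can_comp (tree_autK f) (tree_autK g))
          (can_comp (tree_autVK g) (tree_autVK f)) (tree_aut_mul_adj f g).

Fact tree_aut_mulA : associative tree_aut_mul.
Proof. by move=> f g h; apply: tree_autP. Qed.

Fact tree_aut_mul1 : left_id tree_aut_one tree_aut_mul.
Proof. by move=> f; apply: tree_autP. Qed.

Fact tree_aut_mulr1 : right_id tree_aut_one tree_aut_mul.
Proof. by move=> f; apply: tree_autP. Qed.

Fact tree_aut_mulV : left_inverse tree_aut_one tree_aut_invg tree_aut_mul.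
Proof. by move=> f; apply: tree_autP => x /=; rewrite tree_autK. Qed.

Fact tree_aut_mulrV : right_inverse tree_aut_one tree_aut_invg tree_aut_mul.
Proof. by move=> f; apply: tree_autP => x /=; rewrite tree_autVK. Qed.

HB.instance Definition _ := isGroup.Build (tree_aut T)
  tree_aut_mulA tree_aut_mul1 tree_aut_mulr1 tree_aut_mulV tree_aut_mulrV.

End TreeAutGroup.

Section ProductOfTrees.
Variables (k : nat) (T : 'I_k -> tree).

Definition prod_vertex := forall i, T i.

(* Aut(T_1) x ... x Aut(T_k) *)
Definition factor_aut := forall i, tree_aut (T i).

HB.instance Definition _ := gen_eqMixin factor_aut.
HB.instance Definition _ := gen_choiceMixin factor_aut.

Definition factor_aut_one : factor_aut := fun=> 1.
Definition factor_aut_inv (a : factor_aut) : factor_aut := fun i => (a i)^-1.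
Definition factor_aut_mul (a b : factor_aut) : factor_aut := fun i => a i * b i.

Fact factor_aut_mulA : associative factor_aut_mul.
Proof. by move=> a b c; apply: functional_extensionality_dep => i; apply: mulgA. Qed.

Fact factor_aut_mul1 : left_id factor_aut_one factor_aut_mul.
Proof. by move=> a; apply: functional_extensionality_dep => i; apply: mul1g. Qed.

Fact factor_aut_mulr1 : right_id factor_aut_one factor_aut_mul.
Proof. by move=> a; apply: functional_extensionality_dep => i; apply: mulg1. Qed.

Fact factor_aut_mulV : left_inverse factor_aut_one factor_aut_inv factor_aut_mul.
Proof. by move=> a; apply: functional_extensionality_dep => i; apply: mulVg. Qed.

Fact factor_aut_mulrV : right_inverse factor_aut_one factor_aut_inv factor_aut_mul.
Proof. by move=> a; apply: functional_extensionality_dep => i; apply: mulgV. Qed.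

HB.instance Definition _ := isGroup.Build factor_aut
  factor_aut_mulA factor_aut_mul1 factor_aut_mulr1 factor_aut_mulV factor_aut_mulrV.

Definition factor_act (a : factor_aut) (x : prod_vertex) : prod_vertex :=
  fun i => a i (x i).

Definition vertex_stabiliser (G : groupType) (phi : {multiplicative G -> factor_aut})
    (x : prod_vertex) : set G :=
  [set g | factor_act (phi g) x = x]%classic.

Definition proper_action (G : groupType) (phi : {multiplicative G -> factor_aut}) :=
  forall x : prod_vertex, finite_set (vertex_stabiliser phi x).

End ProductOfTrees.

(* Main.v *)
Require Import Defs.
From HB Require Import structures.
From mathcomp Require Import all_boot.
From mathcomp Require Import boolp classical_sets functions cardinality.

(* For each colour i, the tree T_i has as vertices the left cosets of the      *)
(* subgroup A_i generated by the vertices not coloured i, with an edge from    *)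
(* gA_i to gvA_i for each v of colour i; it is dual to the hyperplanes of      *)
(* colour i in the universal cover of the Salvetti complex. Each edge is the   *)
(* only one crossed by a two-valued function on the vertices, so there are no  *)
(* cycles. If h fixes a vertex kA_i, then h = k a k^-1 with a in A_i, so the   *)
(* reduced words of h have at most 2|k| letters of colour i; an element fixing *)
(* a vertex of the product thus has bounded length. Reduced words are          *)
(* controlled by the pilings of Crisp, Godelle and Wiest.                      *)

Set Implicit Arguments.
Unset Strict Implicit.
Unset Printing Implicit Defensive.

(** Everything rests on a canonical form for group elements. Letters act on the pilings of reduced
    words by pushing or cancelling at the top; this respects the defining relations
    ([foldr_act_eqv]), so [npile g], the piling of any reduced word of [g], depends on [g] alone.

    This has two consequences. By [side_exit], a letter leads out of the half-space [side v] only
    from [v q] to [q], with [q] a word in neighbours of [v]. A colour class is independent, so all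
    these edges become a single edge between cosets, and it separates the coset graph
    ([coset_adj_separated]); hence trees. Moreover no word of [g] has fewer letters of [v] than
    [npile g] records ([count_npile]). So an element fixing a vertex of the product has bounded
    piles in every colour ([coset_stabiliser_bound]), and only finitely many elements do
    ([finite_bounded_piles]). *)

Section Raag.
Variables (V : finType) (Gamma : simple_graph V).
Local Open Scope group_scope.

Implicit Types (u v x y : V) (b : bool) (l : V * bool) (w p q : word V).

(** * Words in the group and their piles *)

Definition rword w : raag Gamma := pres_of (commutation Gamma) w.

Lemma rwordE w1 w2 : rword (w1 ++ w2) = rword w1 * rword w2.
Proof. by rewrite /rword -pres_mulE. Qed.

Lemma rword_nil : rword [::] = 1.
Proof. by []. Qed.

Lemma rword_cons l w : rword (l :: w) = rword [:: l] * rword w.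
Proof. by rewrite -rwordE. Qed.

Lemma rword_surj (g : raag Gamma) : exists w, g = rword w.
Proof. by exists (repr g); rewrite /rword pres_of_repr. Qed.

Lemma rword_cancel x b : rword [:: (x, b)] * rword [:: (x, ~~ b)] = 1.
Proof.
rewrite -rwordE -rword_nil; apply/pres_ofP.
exact: (pres_cancel _ [::] x b [::]).
Qed.

Lemma rword_inv x b : rword [:: (x, ~~ b)] = (rword [:: (x, b)])^-1.
Proof. by rewrite -[RHS]mulg1 -(rword_cancel x b) mulKg. Qed.

Lemma rword_commute l1 l2 :
  Gamma l1.1 l2.1 -> commute (rword [:: l1]) (rword [:: l2]).
Proof.
have pos u v : Gamma u v ->
    commute (rword [:: (u, false)]) (rword [:: (v, false)]).
  move=> uv; rewrite /commute -!rwordE; apply/pres_ofP.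
  exact: (pres_relator [::] [::] (Commutation uv)).
case: l1 l2 => [u b] [v c] /= uv.
have posr : commute (rword [:: (u, false)]) (rword [:: (v, c)]).
  case: c; last exact: pos.
  by rewrite (rword_inv v false); apply: commuteV; apply: pos.
case: b => //; apply: commute_sym.
by rewrite (rword_inv u false); apply: commuteV; apply: commute_sym.
Qed.

Lemma rword_commute_all l p : all (fun l' => Gamma l'.1 l.1) p ->
  commute (rword [:: l]) (rword p).
Proof.
elim: p => [|l' p IHp] /=; first by rewrite rword_nil => _; apply: commute1.
case/andP=> l'l /IHp cp; rewrite (rword_cons l'); apply: commuteM => //.
by apply: rword_commute; rewrite adj_sym.
Qed.

(* The pile over [y] records the letters that do not commute with [y]: a      *)
(* letter of [y] by its sign, any other one by [None].                        *)
Definition mark l y : option (option bool) :=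
  if l.1 == y then Some (Some l.2) else if Gamma l.1 y then None else Some None.

Definition pile w y : seq (option bool) := pmap (mark^~ y) w.

Definition ocons (o : option (option bool)) s := oapp (cons^~ s) s o.

Lemma pile_cons l w y : pile (l :: w) y = ocons (mark l y) (pile w y).
Proof. by []. Qed.

Lemma pile_cat w1 w2 y : pile (w1 ++ w2) y = pile w1 y ++ pile w2 y.
Proof. exact: pmap_cat. Qed.

Lemma mark_self v b : mark (v, b) v = Some (Some b).
Proof. by rewrite /mark eqxx. Qed.

Lemma mark_adj l v : Gamma l.1 v -> mark l v = None.
Proof.
by rewrite /mark => lv; case: eqP => [e|]; [rewrite e adj_irr in lv | rewrite lv].
Qed.

Lemma mark_some l v b : mark l v = Some (Some b) -> l = (v, b).
Proof.
by case: l => u c; rewrite /mark /=; case: eqP => [->[->]|_] //; case: ifP.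
Qed.

Lemma mark_none l v : mark l v = None -> Gamma l.1 v.
Proof. by rewrite /mark; case: ifP => // _; case: ifP. Qed.

Lemma pile_swap l1 l2 w :
  Gamma l1.1 l2.1 -> pile (l1 :: l2 :: w) = pile (l2 :: l1 :: w).
Proof.
move=> adj12; apply: funext => y; rewrite !pile_cons /mark.
case: eqP => [<-|_]; last case: eqP => [<-|_].
- by rewrite adj_sym adj12; case: eqP => [e|]; rewrite ?e ?adj_irr // in adj12 *.
- by rewrite adj12.
- by do 2!case: ifP.
Qed.

Lemma pile_shift l p q :
  all (fun l' => Gamma l'.1 l.1) p -> pile (p ++ l :: q) = pile (l :: p ++ q).
Proof.
elim: p => //= l' p IHp /andP[l'l pl]; rewrite -pile_swap //.
by apply: funext => y; rewrite !(pile_cons l') IHp.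
Qed.

Lemma rword_shift l p q : all (fun l' => Gamma l'.1 l.1) p ->
  rword (p ++ l :: q) = rword (l :: p ++ q).
Proof.
move=> pl; rewrite rwordE (rword_cons l q) mulgA -(rword_commute_all pl).
by rewrite -mulgA (rword_cons l (p ++ q)) rwordE.
Qed.

(** A letter that leaves no mark over [v] is a neighbour of [v], so whatever precedes the top of
    that pile commutes with [v]. *)
Lemma pile_first v b w : ohead (pile w v) = Some (Some b) ->
  exists p q, w = p ++ (v, b) :: q /\ all (fun l => Gamma l.1 v) p.
Proof.
elim: w => [//|l w IHw]; rewrite pile_cons; case E: (mark l v) => [m|] /=.
  by case=> em; rewrite em in E; exists [::], w; rewrite (mark_some E).
case/IHw=> p [q [-> pv]]; exists (l :: p), q; split=> //=.
by rewrite (mark_none E).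
Qed.

Lemma pile_last v b w : last None (pile w v) = Some b ->
  exists p q, w = p ++ (v, b) :: q /\ all (fun l => Gamma l.1 v) q.
Proof.
have nilP q : pile q v = [::] -> all (fun l => Gamma l.1 v) q.
  elim: q => [//|l q IHq]; rewrite pile_cons.
  by case E: (mark l v) => //= /IHq ->; rewrite (mark_none E).
elim: w => [//|l w IHw]; rewrite pile_cons.
case E: (pile w v) => [|m s] in IHw *.
  case F: (mark l v) => [m|] //= em; rewrite em in F.
  by exists [::], w; rewrite (mark_some F); split=> //; apply: nilP.
by case: (mark l v) => [?|] /= /IHw[p [q [-> ?]]]; exists (l :: p), q.
Qed.

(** * Reduced words *)

Definition uncancelled : rel (option bool) :=
  fun s t => if (s, t) is (Some b, Some c) then b == c else true.

(** Letters of [v] consecutive in the pile over [v] are separated in [w] only by letters commuting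
    with them, so opposite signs there reveal a cancellation; a [None] between them blocks it. *)
Definition reduced w := forall v, sorted uncancelled (pile w v).

Lemma reduced_tail l w : reduced (l :: w) -> reduced w.
Proof.
move=> lw v; have := lw v; rewrite pile_cons; case: (mark l v) => //= m.
by move/path_sorted.
Qed.

Lemma reduced_prefix w1 w2 : reduced (w1 ++ w2) -> reduced w1.
Proof.
move=> w12 v; have := w12 v; rewrite pile_cat.
by case: (pile w1 v) => //= m s; rewrite cat_path => /andP[].
Qed.

Lemma reduced_cons l w : reduced w ->
  ohead (pile w l.1) != Some (Some (~~ l.2)) -> reduced (l :: w).
Proof.
move=> rw hd v; have := rw v; rewrite pile_cons /mark.
case: eqP => [e|_]; last by case: ifP => //= _; case: (pile w v).
rewrite -e; move: hd; case: (pile w l.1) => //= [[c|] s] //=.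
by move=> + ->; case: l.2 c => [] [].
Qed.

Lemma reduced_rcons l w : reduced w ->
  last None (pile w l.1) != Some (~~ l.2) -> reduced (w ++ [:: l]).
Proof.
move=> rw hd v; have := rw v; rewrite pile_cat /= /mark.
case: eqP => [e|_] /=; last first.
  case: ifP => _ /=; first by rewrite cats0.
  by case: (pile w v) => //= m s; rewrite cat_path /= => ->; case: (last _ _).
rewrite -e; move: hd; case: (pile w l.1) => //= m s; rewrite cat_path /=.
by move=> + ->; case: (last _ _) => //= c; case: l.2 c => [] [].
Qed.

(** * The action of letters on pilings *)

Definition piling := V -> seq (option bool).

(** Models left multiplication by [l]. *)
Definition act l (P : piling) : piling := fun y =>
  if ohead (P l.1) == Some (Some (~~ l.2)) then
    if mark l y then behead (P y) else P y
  else ocons (mark l y) (P y).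

(* Letters act invertibly only on the pilings of reduced words: elsewhere,     *)
(* pushing a letter need not undo popping its inverse.                         *)
Lemma act_reduced l w : reduced w ->
  exists w', [/\ reduced w', act l (pile w) = pile w', rword (l :: w) = rword w'
    & forall v, count (fun l => l.1 == v) w' <=
                count (fun l => l.1 == v) (l :: w)].
Proof.
move=> rw; case: (boolP (ohead (pile w l.1) == Some (Some (~~ l.2)))) => hd; last first.
  exists (l :: w); split=> //; first exact: reduced_cons.
  by apply: funext => y; rewrite /act (negbTE hd).
have [p [q [ew pl]]] := pile_first (eqP hd).
have ep : pile w = pile ((l.1, ~~ l.2) :: p ++ q) by rewrite ew pile_shift.
exists (p ++ q); split.
- have rl : reduced ((l.1, ~~ l.2) :: p ++ q) by move=> v; rewrite -ep.
  exact: reduced_tail rl.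
- apply: funext => y; rewrite /act hd ep pile_cons /mark /=.
  by case: (l.1 == y) => //=; case: (Gamma _ _).
- rewrite ew rword_cons rword_shift // (rword_cons (_, _)) mulgA.
  by rewrite [l]surjective_pairing rword_cancel mul1g.
- move=> v; rewrite ew /= !count_cat /= [X in _ <= X]addnCA leq_add2l.
  by rewrite addnA leq_addl.
Qed.

Lemma behead_mark l w y :
  ohead (pile w l.1) = Some (Some l.2) ->
  pile w y = ocons (mark l y) (act (l.1, ~~ l.2) (pile w) y).
Proof.
move=> hd; have [p [q [-> pl]]] := pile_first hd.
rewrite -surjective_pairing pile_shift // /act !pile_cons /mark /= !eqxx /=.
rewrite negbK eqxx.
by case: (l.1 == y) => //=; case: (Gamma _ _).
Qed.

Lemma act_cancel x b w : reduced w -> act (x, b) (act (x, ~~ b) (pile w)) = pile w.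
Proof.
move=> rw; apply: funext => y.
case: (boolP (ohead (pile w x) == Some (Some b))) => hd.
  have E z : pile w z = ocons (mark (x, b) z) (act (x, ~~ b) (pile w) z).
    exact: (@behead_mark (x, b)) (eqP hd).
  move: (act (x, ~~ b) (pile w)) E => A E.
  (* Reducedness keeps the entry uncovered by the pop from being the inverse of [(x, b)], so the
     second letter is pushed back. *)
  have := rw x; rewrite /act E E mark_self /=; case: eqP => //=.
  by case: (A x) => //= m s [->] /=; case: b {hd E}.
rewrite /act /= negbK (negbTE hd) mark_self /= eqxx.
by rewrite /mark /=; case: eqP => //= _; case: (Gamma _ _).
Qed.

Lemma act_commute l1 l2 w : Gamma l1.1 l2.1 ->
  act l1 (act l2 (pile w)) = act l2 (act l1 (pile w)).
Proof.
move=> a12; apply: funext => y.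
have a21 : Gamma l2.1 l1.1 by rewrite adj_sym.
have same l P z : Gamma l.1 z -> act l P z = P z.
  by move=> lz; rewrite /act mark_adj //=; case: ifP.
have pop l : ohead (pile w l.1) == Some (Some (~~ l.2)) -> l.1 != y ->
    ~~ Gamma l.1 y -> pile w y = None :: behead (pile w y).
  move=> /eqP hd ly nly.
  have := @behead_mark (l.1, ~~ l.2) w y hd.
  by rewrite /mark /= (negbTE ly) (negbTE nly) /= => ->.
have congr_act l P Q z : P l.1 = Q l.1 -> P z = Q z -> act l P z = act l Q z.
  by rewrite /act => -> ->.
case: (eqVneq l1.1 y) => [<-|n1].
  by rewrite [RHS]same //; apply: congr_act; rewrite same.
case: (eqVneq l2.1 y) => [<-|n2].
  by rewrite [LHS]same //; apply/esym/congr_act; rewrite same.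
case: (boolP (Gamma l1.1 y)) => [g1|g1].
  by rewrite [LHS]same //; apply/esym/congr_act; rewrite same.
case: (boolP (Gamma l2.1 y)) => [g2|g2].
  by rewrite [RHS]same //; apply: congr_act; rewrite same.
(* Both letters now mark the pile over [y] with [None]. By [pop], a letter that cancels removes a
   [None] from it, so a push and a pop agree in either order. *)
rewrite /act !(mark_adj a12) !(mark_adj a21) /= !if_same.
rewrite /mark (negbTE n1) (negbTE n2) (negbTE g1) (negbTE g2) /=.
case: ifP => h1; case: ifP => h2 //=.
- by rewrite -(pop l1).
- by rewrite -(pop l2).
Qed.

Definition nf w : piling := foldr act (pile [::]) w.

Lemma foldr_act_reduced w0 w : reduced w0 ->
  exists w', [/\ reduced w', foldr act (pile w0) w = pile w',
    rword (w ++ w0) = rword w'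
    & forall v, count (fun l => l.1 == v) w' <=
                count (fun l => l.1 == v) (w ++ w0)].
Proof.
move=> r0; elim: w => [|l w [w' [rw' ew gw cw]]]; first by exists w0; split.
have [w'' [rw'' ew' gw' cw']] := act_reduced l rw'.
exists w''; split=> //=; first by rewrite ew.
- by rewrite -gw' rword_cons gw -rword_cons.
- by move=> v; apply: leq_trans (cw' v) _; rewrite leq_add2l cw.
Qed.

Lemma foldr_act_eqv w1 w2 w : pres_eqv (commutation Gamma) w1 w2 -> reduced w ->
  foldr act (pile w) w1 = foldr act (pile w) w2.
Proof.
move=> e; elim: e w => {w1 w2} [//|w1 w2 _ h|w1 w2 w3 _ h _ h'|u x b v|u w1 w2 v].
- by move=> w rw; rewrite h.
- by move=> w rw; rewrite h ?h'.
- move=> w rw; rewrite !foldr_cat; have [w' [rw' -> _ _]] := foldr_act_reduced v rw.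
  by rewrite /= act_cancel.
- case=> {w1 w2} x y xy w rw; rewrite !foldr_cat.
  by have [w' [rw' -> _ _]] := foldr_act_reduced v rw; rewrite /= act_commute.
Qed.

Lemma reduced_nil : reduced [::].
Proof. by []. Qed.

Lemma nf_reduced w : reduced w -> nf w = pile w.
Proof.
elim: w => // l w IHw rw; rewrite /= -/(nf w) IHw; last exact: reduced_tail rw.
apply: funext => y; rewrite pile_cons /act ifF //.
have := rw l.1; rewrite pile_cons /mark eqxx /=.
by case: (pile w l.1) => //= [[c|] s] //=; case: l.2 c => [] [].
Qed.

Definition npile (g : raag Gamma) : piling := nf (repr g).

Lemma npileE w : npile (rword w) = nf w.
Proof.
apply: (foldr_act_eqv _ reduced_nil); apply/pres_ofP.
by rewrite pres_of_repr.
Qed.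

Lemma raag_reduced w : exists w', [/\ reduced w', rword w = rword w'
    & forall v, count (fun l => l.1 == v) w' <= count (fun l => l.1 == v) w].
Proof.
have [w' [rw' _ gw cw]] := foldr_act_reduced w reduced_nil.
by exists w'; rewrite cats0 in gw cw.
Qed.

Lemma count_pile v w : count isSome (pile w v) = count (fun l => l.1 == v) w.
Proof.
elim: w => [//|l w IHw]; rewrite pile_cons /= -IHw /mark.
by case: eqP => //= _; case: ifP.
Qed.

Lemma count_npile v w :
  count isSome (npile (rword w) v) <= count (fun l => l.1 == v) w.
Proof.
have [w' [rw' -> cw]] := raag_reduced w.
by rewrite npileE nf_reduced // count_pile.
Qed.

Lemma size_count w : size w = \sum_v count (fun l => l.1 == v) w.
Proof.
elim: w => [|l w IHw] /=; first by rewrite big1.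
rewrite big_split /= -IHw (bigD1 l.1) //= eqxx big1 // => v.
by rewrite eq_sym => /negbTE ->.
Qed.

(** The letters of [v] in a reduced word are the [Some] entries of its pile over [v], so the bounds
    limit the length of reduced words over a finite alphabet. *)
Lemma finite_bounded_piles (M : V -> nat) (A : set (raag Gamma)) :
  (forall g v, A g -> count isSome (npile g v) <= M v) -> finite_set A.
Proof.
move=> AM; pose f (s : (\sum_v M v).-bseq (V * bool)) := rword s.
apply: (@sub_finite_set _ _ (range f)); last exact: finite_image finite_finset.
move=> g Ag; have [w0 eg0] := rword_surj g.
have [w [rw eg _]] := raag_reduced w0.
have sw : size w <= \sum_v M v.
  rewrite size_count; apply: leq_sum => v _; rewrite -count_pile -nf_reduced //.
  by rewrite -npileE -eg -eg0 AM.
by exists (Bseq sw) => //; rewrite /f eg0 eg.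
Qed.

(** * Half-spaces *)

Lemma rword_word_inv w : rword (word_inv w) = (rword w)^-1.
Proof.
apply: (mulgI (rword w)); rewrite mulgV -rwordE -rword_nil; apply/pres_ofP.
exact: pres_eqv_mulV.
Qed.

(* The elements [g] with [side v g] are those of the half-space beyond the    *)
(* hyperplane dual to the edge from [1] to [v].                               *)
Definition side v (g : raag Gamma) := ohead (npile g v) == Some (Some false).

Lemma rword_pop l p q : all (fun l' => Gamma l'.1 l.1) q ->
  rword (p ++ (l.1, ~~ l.2) :: q) * rword [:: l] = rword (p ++ q).
Proof.
move=> ql; rewrite !rwordE (rword_cons (_, _)) -!mulgA.
rewrite -(rword_commute_all ql) rword_inv -surjective_pairing.
by rewrite mulKg.
Qed.

(** Take a reduced word of [g] beginning with [v]. Unless [l] cancels that first letter, the product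
    still has a reduced word beginning with [v]. *)
Lemma side_exit v g l : side v g -> ~~ side v (g * rword [:: l]) ->
  l = (v, true) /\
  exists2 q, all (fun l' => Gamma l'.1 v) q & g = rword ((v, false) :: q).
Proof.
have [w0 ->] := rword_surj g; have [w1 [r1 -> _]] := raag_reduced w0.
rewrite {1}/side npileE nf_reduced // => /eqP hd.
have [p [q [ew pv]]] := pile_first hd.
have rw : reduced ((v, false) :: p ++ q) by move=> y; rewrite -pile_shift // -ew.
rewrite ew rword_shift //; move: (p ++ q) rw => w rw {p q ew pv hd r1 w1 w0 g}.
case: (boolP (last None (pile ((v, false) :: w) l.1) == Some (~~ l.2))) => hl.
  have [p [q [ew ql]]] := pile_last (eqP hl).
  case: p ew => [|l' p] [].
    move=> ev el ->; split; last by exists q; rewrite ?ev.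
    by rewrite [l]surjective_pairing -ev -[l.2]negbK -el.
  move=> _ ew; rewrite ew -cat_cons rword_pop // /side npileE nf_reduced.
    by rewrite pile_cons mark_self.
  (* Moving the cancelled letter to the end exhibits the remaining word as a prefix of a reduced
     one. *)
  apply: (@reduced_prefix _ [:: (l.1, ~~ l.2)]) => y.
  rewrite -catA pile_cat pile_shift // cats0 -pile_cat cat_cons -ew.
  exact: rw.
rewrite -rwordE /side npileE nf_reduced; last exact: reduced_rcons.
by rewrite cat_cons pile_cons mark_self.
Qed.

(** * The tree of a colour class *)

Section ColourClass.
Variable C : pred V.
Hypothesis indepC : forall u v, C u -> C v -> ~~ Gamma u v.

Definition coset_rel (g h : raag Gamma) : bool :=
  `[< exists2 w, all (fun l => ~~ C l.1) w & h = g * rword w >].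

Fact coset_rel_refl : reflexive coset_rel.
Proof. by move=> g; apply/asboolP; exists [::]; rewrite ?rword_nil ?mulg1. Qed.

Fact coset_rel_sym : symmetric coset_rel.
Proof.
suff sub g h : coset_rel g h -> coset_rel h g by move=> g h; apply/idP/idP; apply: sub.
case/asboolP=> w wC ->; apply/asboolP; exists (word_inv w).
  by rewrite all_rev all_map.
by rewrite rword_word_inv mulgK.
Qed.

Fact coset_rel_trans : transitive coset_rel.
Proof.
move=> h g k /asboolP[w wC ->] /asboolP[w' wC' ->]; apply/asboolP.
by exists (w ++ w'); rewrite ?all_cat ?wC // rwordE mulgA.
Qed.

Canonical coset_equiv :=
  EquivRel coset_rel coset_rel_refl coset_rel_sym coset_rel_trans.

Definition colour_coset : Type := {eq_quot coset_equiv}%qT.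
HB.instance Definition _ := Choice.on colour_coset.
HB.instance Definition _ := EqQuotient.on colour_coset.

Definition cos (g : raag Gamma) : colour_coset := (\pi g)%qT.

Lemma cosP g h :
  cos g = cos h <-> exists2 w, all (fun l => ~~ C l.1) w & h = g * rword w.
Proof.
split=> [/eqmodP gh|gh]; first exact/asboolP/gh.
by apply/eqmodP; rewrite /= /coset_rel; apply/asboolP.
Qed.

Lemma cos_repr (t : colour_coset) : cos (repr t) = t.
Proof. exact: reprK. Qed.

Lemma cos_mulr g w : all (fun l => ~~ C l.1) w -> cos (g * rword w) = cos g.
Proof. by move=> wC; apply/esym/cosP; exists w. Qed.

Definition coset_act g (t : colour_coset) : colour_coset := cos (g * repr t).

Lemma coset_actE g h : coset_act g (cos h) = cos (g * h).
Proof.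
rewrite /coset_act; move: (repr _) (cos_repr (cos h)) => k /cosP[w wC ->].
by rewrite mulgA cos_mulr.
Qed.

Definition coset_edge (s t : colour_coset) :=
  exists g v, [/\ C v, s = cos g & t = cos (g * rword [:: (v, false)])].

Definition coset_adj (s t : colour_coset) : bool :=
  `[< coset_edge s t \/ coset_edge t s >].

Lemma coset_edge_act g s t :
  coset_edge s t -> coset_edge (coset_act g s) (coset_act g t).
Proof.
by case=> h [v [Cv -> ->]]; exists (g * h), v; rewrite !coset_actE mulgA.
Qed.

(** Leaving the half-space takes a letter of [v], and entering it is leaving in reverse. Hence
    [side v] descends to cosets. *)
Lemma side_mulr v g w : C v -> all (fun l => ~~ C l.1) w ->
  side v (g * rword w) = side v g.
Proof.
move=> Cv; have exit h l : ~~ C l.1 -> side v h -> side v (h * rword [:: l]).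
  by move=> lC sh; apply: contraNT lC => /(side_exit sh)[->].
elim: w g => [|l w IHw] g /=; first by rewrite rword_nil mulg1.
case/andP=> lC wC; rewrite rword_cons mulgA IHw //.
apply/idP/idP => [|]; last exact: exit.
move/(exit _ (l.1, ~~ l.2)) => /(_ lC).
by rewrite rword_inv -surjective_pairing mulgK.
Qed.

(** The edge must enter the half-space, so it runs from [q] to [q v = v q] with [q] a word in
    neighbours of [v]; independence of [C] puts the letters of [q] outside [C]. *)
Lemma side_edge v u g : C v -> C u ->
  side v g != side v (g * rword [:: (u, false)]) ->
  cos g = cos 1 /\ cos (g * rword [:: (u, false)]) = cos (rword [:: (v, false)]).
Proof.
move=> Cv Cu; have lkC q : all (fun l => Gamma l.1 v) q -> all (fun l => ~~ C l.1) q.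
  by apply: sub_all => l; apply: contraTN => Cl; apply: indepC.
case: (boolP (side v g)) => sg.
  by rewrite eq_sym eqb_id => /(side_exit sg)[].
rewrite eq_sym eqbF_neg negbK => sgu.
have eg : g = g * rword [:: (u, false)] * rword [:: (u, true)].
  by rewrite (rword_inv u false) mulgK.
rewrite eg in sg; have [[eu] [q qv egu]] := side_exit sgu sg.
have -> : g = rword q.
  rewrite eg egu eu rword_cons (rword_inv v false).
  rewrite (_ : _ * rword q = rword q * rword [:: (v, false)]) ?mulgK //.
  exact: (@rword_commute_all (v, false)).
split; first by rewrite -[rword q]mul1g cos_mulr ?lkC.
rewrite eu -(rword_commute_all (l := (v, false))) // -rword_cons.
by rewrite rword_cons cos_mulr ?lkC.
Qed.

Lemma coset_edge_separated s t : coset_edge s t ->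
  exists S : colour_coset -> bool, S s != S t /\
    forall s' t', coset_edge s' t' -> S s' != S t' -> s' = s /\ t' = t.
Proof.
case=> g [v [Cv -> ->]].
(* The half-space at [1], translated by [g]; by [side_mulr] the choice of representative does not
   matter. *)
pose S (t : colour_coset) := side v (g^-1 * repr t).
have SE h : S (cos h) = side v (g^-1 * h).
  rewrite /S; move: (repr _) (cos_repr (cos h)) => k /cosP[w wC ->].
  by rewrite mulgA side_mulr.
exists S; split=> [|_ _ [h [u [Cu -> ->]]]].
  rewrite !SE mulKg mulVg -rword_nil /side !npileE /nf /= /act /=.
  by rewrite mark_self.
rewrite !SE mulgA => /(side_edge Cv Cu)[].
have cosg k k' : cos (g^-1 * k) = cos k' -> cos k = cos (g * k').
  by move=> e; rewrite -[k in LHS](mulVKg g) -coset_actE e coset_actE.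
by rewrite -mulgA => /cosg -> /cosg ->; rewrite mulg1.
Qed.

Lemma coset_adj_sym : symmetric coset_adj.
Proof. by move=> s t; apply/asboolP/asboolP; case; [right|left|right|left]. Qed.

Lemma coset_adj_separated s t : coset_adj s t ->
  exists S : colour_coset -> bool, S s != S t /\
    forall s' t', coset_adj s' t' -> S s' != S t' ->
      (s' = s /\ t' = t) \/ (s' = t /\ t' = s).
Proof.
case/asboolP=> /coset_edge_separated[S [Sst SP]]; exists S.
- split=> // s' t' /asboolP[] /SP sp; first by move/sp; left.
  by rewrite eq_sym => /sp[-> ->]; right.
- split=> [|s' t' /asboolP[] /SP sp]; first by rewrite eq_sym.
    by move/sp; right.
  by rewrite eq_sym => /sp[-> ->]; left.
Qed.

Lemma coset_adj_irr : irreflexive coset_adj.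
Proof.
move=> s; apply/negbTE/negP => /coset_adj_separated[S [+ _]].
by rewrite eqxx.
Qed.

Definition coset_graph : simple_graph colour_coset :=
  SimpleGraph coset_adj_sym coset_adj_irr.

(** A word of the quotient of two representatives traces the path; letters outside [C] stay at the
    same vertex. *)
Lemma coset_connected (s t : colour_coset) :
  exists2 p : seq colour_coset, path coset_graph s p & last s p = t.
Proof.
rewrite -(cos_repr s) -(cos_repr t) -[repr t](mulVKg (repr s)).
have [w ->] := rword_surj ((repr s)^-1 * repr t).
elim: w (repr s) => [|l w IHw] g; first by exists [::]; rewrite //= mulg1.
rewrite rword_cons mulgA; have [p gp lp] := IHw (g * rword [:: l]).
case: (boolP (C l.1)) => Cl; last first.
  have e : cos (g * rword [:: l]) = cos g by rewrite cos_mulr //= Cl.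
  by exists p; rewrite -e.
exists (cos (g * rword [:: l]) :: p) => //=; rewrite gp andbT.
apply/asboolP; case: l Cl {IHw gp lp} => v [] /= Cv.
  right; exists (g * rword [:: (v, true)]), v; split=> //.
  by rewrite (rword_inv v false) mulgVK.
by left; exists g, v.
Qed.

Lemma coset_acyclic (c : seq colour_coset) : ucycle coset_graph c -> size c <= 2.
Proof.
case/andP; case: c => [|s [|t [|r p']]] //; set p := r :: p'.
rewrite /cycle rcons_path => /andP[]; case/andP=> st tp ps /andP[sN /andP[tN _]].
have [S [Sst SP]] := coset_adj_separated st.
(* The rest of the cycle avoids [s], so it never crosses the edge [s t]; the closing edge would then
   have to be [s t] again. *)
have constS (q : seq colour_coset) (x : colour_coset) :
    path coset_graph x q -> s \notin x :: q -> S x = S (last x q).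
  elim: q x => //= y q IHq x /andP[xy yq]; rewrite inE negb_or => /andP[sx sq].
  rewrite -(IHq y) //; apply/eqP/negPn/negP => /(SP _ _ xy)[][e1 e2].
    by rewrite e1 eqxx in sx.
  by rewrite e2 inE eqxx in sq.
have Sl := constS p t tp sN.
have [|[e _]|[e _]] := SP _ _ ps; first by rewrite -Sl eq_sym.
  by have := mem_last t p; rewrite [last t p]e (negbTE sN).
by have := mem_last r p'; rewrite [last r p']e (negbTE tN).
Qed.

Definition coset_tree : tree :=
  Tree (inhabits (cos 1)) coset_connected coset_acyclic.

(** * The action on the tree and its stabilisers *)

Lemma coset_actK g : cancel (coset_act g) (coset_act g^-1).
Proof. by move=> t; rewrite -(cos_repr t) !coset_actE mulKg. Qed.

Lemma coset_actVK g : cancel (coset_act g^-1) (coset_act g).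
Proof. by move=> t; rewrite -(cos_repr t) !coset_actE mulVKg. Qed.

Lemma coset_act_adj g : {mono coset_act g : s t / tree_adj coset_tree s t}.
Proof.
move=> s t; apply/asboolP/asboolP; last first.
  by case=> /(coset_edge_act g); [left|right].
by case=> /(coset_edge_act g^-1); rewrite !coset_actK; [left|right].
Qed.

Definition coset_aut g : tree_aut coset_tree :=
  @TreeAut coset_tree _ _ (coset_actK g) (coset_actVK g) (coset_act_adj g).

Lemma coset_autM g h : coset_aut (g * h) = coset_aut g * coset_aut h.
Proof.
by apply: tree_autP => t /=; rewrite -(cos_repr t) !coset_actE mulgA.
Qed.

Lemma coset_stabiliser_bound g k v : C v -> coset_act g (cos (rword k)) = cos (rword k) ->
  count isSome (npile g v) <= (size k).*2.
Proof.
move=> Cv; rewrite coset_actE => /esym/cosP[w wC gk].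
have wv : count (fun l => l.1 == v) w = 0%N.
  apply/eqP; rewrite -leqn0 leqNgt -has_count; apply/hasPn => l /(allP wC).
  by apply: contraNN => /eqP ->.
have -> : g = rword (k ++ w ++ word_inv k).
  by rewrite !rwordE rword_word_inv mulgA -gk mulgK.
apply: leq_trans (count_npile _ _) _; rewrite !count_cat wv add0n -addnn.
by apply: leq_add; apply: leq_trans (count_size _ _) _; rewrite ?size_rev ?size_map.
Qed.

End ColourClass.

End Raag.

Theorem corollary5p2 (V : finType) (Gamma : simple_graph V) (k : nat)
  (hk : chromatic_number Gamma = k) :
  exists (T : 'I_k -> tree) (phi : {multiplicative raag Gamma -> factor_aut T}),
    proper_action phi.
Proof.
have [c cP] : exists c : V -> 'I_k, forall u v, Gamma u v -> c u != c v.
  move: hk; rewrite /chromatic_number; case: ex_minnP => m /existsP[c cP] _ <-.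
  by exists c => u v; apply/implyP; move/forallP/(_ u)/forallP: cP.
have indep i u v : c u == i -> c v == i -> ~~ Gamma u v.
  by move=> /eqP ui /eqP vi; apply/negP => /cP; rewrite ui vi eqxx.
pose T i := coset_tree (indep i).
pose f (g : raag Gamma) : factor_aut T := fun i => coset_aut (indep i) g.
have fM : {morph f : g h / (g * h)%g}.
  by move=> g h; apply: functional_extensionality_dep => i; apply: coset_autM.
pose phiM := isMultiplicative.Build (raag Gamma) (factor_aut T) f fM.
pose phi : {multiplicative raag Gamma -> factor_aut T} := HB.pack f phiM.
exists T, phi => x.
have /choice[w wP] (i : 'I_k) :
    exists w, x i = cos (fun v => c v == i) (rword Gamma w).
  have [w ew] := rword_surj (repr (x i : colour_coset Gamma _)).
  by exists w; rewrite -ew cos_repr.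
(* Letters of [v] are bounded through the coordinate of its own colour [c v]. *)
apply: (@finite_bounded_piles _ _ (fun v => (size (w (c v))).*2)) => g v gx.
apply: (@coset_stabiliser_bound _ _ (fun u => c u == c v)); first exact: eqxx.
rewrite -wP; exact: (congr1 (fun y => y (c v)) gx).
Qed.
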